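(* Let $(M,g)$ be a $3$-dimensional Riemannian manifold equipped with a Newman--Penrose frame $(\partial,\overline{\partial},\xi)$. Then $$\operatorname{div}(\xi)=2\Theta_{\mathrm{np}}.$$
   Context: $\nabla$ is the Levi-Civita connection of $g$. Newman--Penrose frame: for an orthonormal frame $(e_1,e_2,\xi)$ of $(M,g)$, $\partial=\frac1{\sqrt2}(e_1-ie_2)$ and $\overline{\partial}=\frac1{\sqrt2}(e_1+ie_2)$; $g$ and $\nabla$ are extended complex-(bi)linearly. $\rho_{\mathrm{np}}=g(\partial,\nabla_{\overline{\partial}}\xi)=\Theta_{\mathrm{np}}+i\omega_{\mathrm{np}}$ with $\Theta_{\mathrm{np}},\omega_{\mathrm{np}}$ real ($\Theta_{\mathrm{np}}$ is called the expansion of $\xi$). The divergence is $\operatorname{div}(X)=\sum_{i=1}^3g(\nabla_{e_i}X,e_i)$ for a local orthonormal frame $(e_1,e_2,e_3)$. *)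

(* Defs.v *)
From HB Require Import structures.
From mathcomp Require Import all_boot all_order all_algebra.
From mathcomp Require Import boolp classical_sets functions reals topology.
From mathcomp Require Import normedtype landau derive.
From mathcomp Require Import complex.
Set Implicit Arguments.
Unset Strict Implicit.
Unset Printing Implicit Defensive.
Import Order.TTheory GRing.Theory Num.Theory.
Import numFieldNormedType.Exports.
Local Open Scope classical_set_scope.
Local Open Scope ring_scope.

Section smooth_on.
Context {R : realType} {V W : normedModType R}.

(* For U open and V of finite dimension: a differentiable map is C^(k+1) iff
   all its directional derivatives are C^k. *)
Fixpoint Ck_on (k : nat) (U : set V) (f : V -> W) : Prop :=
  if k is k'.+1 then
    (forall x, U x -> differentiable f x) /\
    (forall v, Ck_on k' U (fun x => 'D_v f x))
  else forall x, U x -> {for x, continuous f}.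

Definition smooth_on (U : set V) (f : V -> W) := forall k, Ck_on k U f.

Lemma near_eq_differentiable (f g : V -> W) (x : V) :
  (\forall y \near x, f y = g y) -> differentiable f x -> differentiable g x.
Proof.
move=> fg df; have fgx : f x = g x := nbhs_singleton fg.
have dg : g \o shift x = cst (g x) + 'd f x +o_ 0 id.
  apply/eqaddoP => e e0.
  have /eqaddoP/(_ e e0) := diff_locally df.
  move: fg; rewrite (near_shift 0 x) subr0; apply: filterS2 => h /= fgh.
  by rewrite !fctE/= fgx fgh.
apply/diff_locallyP.
have -> : 'd g x = 'd f x :> (V -> W).
  exact: (diff_unique (diff_continuous df) dg).
by split; [exact: diff_continuous|exact: dg].
Qed.

Lemma Ck_on_ext k (U : set V) (f g : V -> W) : open U ->
  (forall x, U x -> f x = g x) -> Ck_on k U f -> Ck_on k U g.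
Proof.
move=> oU; have fgx (f' g' : V -> W) x : (forall y, U y -> f' y = g' y) ->
    U x -> \forall y \near x, f' y = g' y.
  by move=> fg Ux; apply: filterS (open_nbhs_nbhs (conj oU Ux)) => y /fg.
elim: k f g => [|k IH] f g fg /=.
  move=> fc x Ux; rewrite /prop_for /continuous_at -(fg x Ux).
  exact: (cvg_trans (near_eq_cvg (fgx _ _ _ fg Ux)) (fc x Ux)).
move=> [fd fD]; split=> [x Ux|v].
  exact: (near_eq_differentiable (fgx _ _ _ fg Ux) (fd x Ux)).
apply: (IH (fun x => 'D_v f x)) => // x Ux.
by apply: near_eq_derive; exact: fgx.
Qed.

Lemma Ck_on_differentiable k (U : set V) (f : V -> W) x :
  Ck_on k.+1 U f -> U x -> differentiable f x.
Proof. by case=> fd _ /fd. Qed.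

Lemma Ck_onW k (U : set V) (f : V -> W) : Ck_on k.+1 U f -> Ck_on k U f.
Proof.
elim: k f => [|k IH] f [fd fD].
  by move=> x /fd; exact: differentiable_continuous.
by split=> // v; apply: IH; exact: fD.
Qed.

Lemma Ck_on_cst k (U : set V) (a : W) : Ck_on k U (cst a).
Proof.
elim: k a => [|k IH] a /=; first by move=> x _; exact: cst_continuous.
split=> [x _|v]; first exact: differentiable_cst.
have -> : (fun x => 'D_v (cst a) x) = cst 0.
  by apply/funext => x; exact: derive_cst.
exact: IH.
Qed.

Lemma Ck_onD k (U : set V) (f g : V -> W) : open U ->
  Ck_on k U f -> Ck_on k U g -> Ck_on k U (f \+ g).
Proof.
move=> oU; elim: k f g => [|k IH] f g.
  by move=> fc gc x Ux; apply: continuousD; [exact: fc|exact: gc].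
move=> [fd fD] [gd gD]; split=> [x Ux|v].
  by apply: differentiableD; [exact: fd|exact: gd].
apply: (Ck_on_ext oU _ (IH _ _ (fD v) (gD v))) => x Ux /=.
by rewrite -deriveD//; apply: diff_derivable; [exact: fd|exact: gd].
Qed.

End smooth_on.

Lemma Ck_onM (R : realType) (V : normedModType R) k (U : set V)
  (f g : V -> R) : open U -> Ck_on k U f -> Ck_on k U g -> Ck_on k U (f \* g).
Proof.
move=> oU; elim: k f g => [|k IH] f g.
  by move=> fc gc x Ux; apply: continuousM; [exact: fc|exact: gc].
move=> fk gk; have [[fd fD] [gd gD]] := (fk, gk); split=> [x Ux|v].
  by apply: differentiableM; [exact: fd|exact: gd].
have := Ck_onD oU (IH _ _ (Ck_onW fk) (gD v)) (IH _ _ (Ck_onW gk) (fD v)).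
apply: (Ck_on_ext oU) => x Ux /=.
by rewrite [RHS]deriveM//; apply: diff_derivable; [exact: fd|exact: gd].
Qed.

Record chart (R : realType) (n : nat) (M : topologicalType) := Chart {
  chart_dom : set M;
  chart_cod : set 'rV[R]_n;
  chart_map : M -> 'rV[R]_n;
  chart_inv : 'rV[R]_n -> M;
  chart_dom_open : open chart_dom;
  chart_cod_open : open chart_cod;
  chart_map_cod : forall p, chart_dom p -> chart_cod (chart_map p);
  chart_inv_dom : forall x, chart_cod x -> chart_dom (chart_inv x);
  chart_mapK : forall p, chart_dom p -> chart_inv (chart_map p) = p;
  chart_invK : forall x, chart_cod x -> chart_map (chart_inv x) = x;
  chart_map_continuous : {within chart_dom, continuous chart_map};
  chart_inv_continuous : {within chart_cod, continuous chart_inv} }.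

(* The part of the image of phi that parametrizes U. *)
Definition chart_image R n (M : topologicalType) (phi : chart R n M)
  (U : set M) : set 'rV[R]_n := chart_cod phi `&` chart_inv phi @^-1` U.

Record manifold (R : realType) (n : nat) := Manifold {
  msort :> topologicalType;
  manifold_hausdorff : hausdorff_space msort;
  manifold_second_countable : @second_countable msort;
  atlas : set (chart R n msort);
  atlas_cover : forall p, exists2 phi, atlas phi & chart_dom phi p;
  atlas_compatible : forall phi psi, atlas phi -> atlas psi ->
    smooth_on (chart_image phi (chart_dom psi))
      (chart_map psi \o chart_inv phi) }.

Section manifold.
Context {R : realType} {n : nat} (M : manifold R n).

Definition smooth_in (U : set M) (f : M -> R) := forall phi, atlas phi ->
  smooth_on (chart_image phi U) (f \o chart_inv phi).

Definition smooth_pred : {pred M -> R} := fun f => `[< smooth_in setT f >].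

Record smoothfun := SmoothFun {
  smoothfun_val :> M -> R;
  smoothfunP : smoothfun_val \in smooth_pred }.

Lemma open_chart_imageT (phi : chart R n M) : open (chart_image phi [set: M]).
Proof. by rewrite /chart_image preimage_setT setIT; exact: chart_cod_open. Qed.

Fact smooth_subring : subring_closed smooth_pred.
Proof.
have smoothM f g : smooth_in setT f -> smooth_in setT g ->
    smooth_in setT (f * g).
  move=> fs gs phi aphi k.
  exact (Ck_onM (@open_chart_imageT phi) (fs _ aphi k) (gs _ aphi k)).
have smooth_cst a : smooth_in setT (cst a).
  by move=> phi _ k; exact: Ck_on_cst.
split=> [|f g|f g]; rewrite ?unfold_in.
- by apply/asboolP; exact: smooth_cst.
- move=> /asboolP fs /asboolP gs; apply/asboolP => phi aphi k.
  have -> : f - g = f + cst (-1) * g.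
    by apply/funext => p; rewrite !fctE mulN1r.
  apply: (Ck_onD (@open_chart_imageT phi) (fs _ aphi k)).
  exact: (smoothM _ _ (smooth_cst _) gs _ aphi k).
- by move=> /asboolP fs /asboolP gs; apply/asboolP; exact: smoothM.
Qed.

HB.instance Definition _ := GRing.isSubringClosed.Build (M -> R) smooth_pred
  smooth_subring.

Fact smooth_subsemimod : subsemimod_closed smooth_pred.
Proof.
split; first by split; [exact: rpred0|exact: rpredD].
move=> a f fs; have -> : a *: f = cst a * f by [].
apply: rpredM => //; rewrite unfold_in; apply/asboolP => phi _ k.
exact: Ck_on_cst.
Qed.

HB.instance Definition _ := GRing.isSubSemiModClosed.Build R (M -> R)
  smooth_pred smooth_subsemimod.

HB.instance Definition _ := [isSub for smoothfun_val].
HB.instance Definition _ := [Choice of smoothfun by <:].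
HB.instance Definition _ := 
  GRing.SubChoice_isSubComPzRing.Build (M -> R) smooth_pred smoothfun
    smooth_subring.
HB.instance Definition _ := [SubZmodule_isSubLmodule of smoothfun by <:].

Definition derivation_at (p : M) (v : smoothfun -> R) :=
  (forall a f g, v (a *: f + g) = a * v f + v g) /\
  (forall f g, v (f * g) = f p * v g + g p * v f).

Definition derivation_pred (p : M) : {pred smoothfun -> R} :=
  fun v => `[< derivation_at p v >].

Record tangent (p : M) := Tangent {
  tangent_val :> smoothfun -> R;
  tangentP : tangent_val \in derivation_pred p }.

Fact derivation_subsemimod p : subsemimod_closed (derivation_pred p).
Proof.
split; first split; rewrite ?unfold_in.
- have z f : (0 : smoothfun -> R) f = 0 by [].
  by apply/asboolP; split=> *; rewrite !z ?mulr0 addr0.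
- move=> u v /asboolP[uZ uM] /asboolP[vZ vM]; apply/asboolP.
  split=> [a f g|f g]; rewrite !fctE.
    by rewrite uZ vZ mulrDr addrACA.
  by rewrite uM vM !mulrDr addrACA.
- move=> a u /asboolP[uZ uM]; apply/asboolP.
  split=> [b f g|f g]; rewrite !fctE /GRing.scale/=.
    by rewrite uZ mulrDr mulrCA.
  by rewrite uM mulrDr !(mulrCA a).
Qed.

HB.instance Definition _ p := GRing.isSubmodClosed.Build R (smoothfun -> R)
  (derivation_pred p) (derivation_subsemimod p).
HB.instance Definition _ p := [isSub for @tangent_val p].
HB.instance Definition _ p := [Choice of tangent p by <:].
HB.instance Definition _ p := [SubChoice_isSubLmodule of tangent p by <:].

(* X is defined on all of M only for convenience: its values outside U are
   irrelevant.  Testing smoothness on global functions is enough, by bump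
   functions; likewise global fields are enough in metric_smooth below. *)
Definition smooth_section (U : set M) (X : forall p, tangent p) :=
  forall f : smoothfun, smooth_in U (fun p => X p f).

Record vector_field := VectorField {
  vf_val :> forall p, tangent p;
  vf_smooth : smooth_section setT vf_val }.

Definition mk_smoothfun (f : M -> R) (fs : smooth_in setT f) : smoothfun :=
  SmoothFun (asboolT fs : f \in smooth_pred).

Definition vf_apply (X : vector_field) (f : smoothfun) : smoothfun :=
  mk_smoothfun (vf_smooth X f).

Fact vf_add_smooth (X Y : vector_field) :
  smooth_section setT (fun p => X p + Y p).
Proof.
by move=> f; have /asboolP := smoothfunP (vf_apply X f + vf_apply Y f).
Qed.

Definition vf_add X Y := VectorField (vf_add_smooth X Y).

Fact vf_scale_smooth (f : smoothfun) (X : vector_field) :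
  smooth_section setT (fun p => f p *: X p).
Proof. by move=> h; have /asboolP := smoothfunP (f * vf_apply X h). Qed.

Definition vf_scale f X := VectorField (vf_scale_smooth f X).

Record riemannian_metric := RiemannianMetric {
  metric :> forall p, tangent p -> tangent p -> R;
  metric_linear : forall p a (u v w : tangent p),
    metric (a *: u + v) w = a * metric u w + metric v w;
  metric_sym : forall p (u v : tangent p), metric u v = metric v u;
  metric_pos : forall p (v : tangent p), v != 0 -> 0 < metric v v;
  metric_smooth : forall X Y : vector_field,
    smooth_in setT (fun p => metric (X p) (Y p)) }.

Definition metric_apply (g : riemannian_metric) (X Y : vector_field) :
  smoothfun := mk_smoothfun (metric_smooth g X Y).

(* nabla v X is the covariant derivative at p of X in the direction v of
   T_p M; C^oo(M)-linearity in the direction is linearity at each point. *)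
Record connection := Connection {
  nabla :> forall p, tangent p -> vector_field -> tangent p;
  nabla_linear : forall p a (u v : tangent p) X,
    nabla (a *: u + v) X = a *: nabla u X + nabla v X;
  nabla_add : forall p (v : tangent p) X Y,
    nabla v (vf_add X Y) = nabla v X + nabla v Y;
  nabla_leibniz : forall p (v : tangent p) (f : smoothfun) X,
    nabla v (vf_scale f X) = v f *: X p + f p *: nabla v X;
  nabla_smooth : forall X Y : vector_field,
    smooth_section setT (fun p => nabla (X p) Y) }.

Definition metric_compatible (g : riemannian_metric) (D : connection) :=
  forall p (v : tangent p) (X Y : vector_field),
    v (metric_apply g X Y) = g p (D p v X) (Y p) + g p (X p) (D p v Y).

Definition torsion_free (D : connection) :=
  forall (X Y : vector_field) p (f : smoothfun),
    (D p (X p) Y - D p (Y p) X) f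
    = X p (vf_apply Y f) - Y p (vf_apply X f).

Definition levi_civita g D := metric_compatible g D /\ torsion_free D.

Definition orthonormal_frame (g : riemannian_metric) (U : set M)
    (E : 'I_n -> forall p, tangent p) :=
  [/\ forall i, smooth_section U (E i),
      forall p, U p -> forall i j, g p (E i p) (E j p) = (i == j)%:R
    & forall p, U p -> forall v : tangent p,
        exists c : 'I_n -> R, v = \sum_i c i *: E i p].

Definition divergence (g : riemannian_metric) (D : connection)
    (E : 'I_n -> forall p, tangent p) (X : vector_field) (p : M) : R :=
  \sum_i g p (D p (E i p) X) (E i p).

End manifold.

(* In the complexification of V, the pair (u, v) stands for u + i v. *)

Section complexified.
Context {R : realType} (V : lmodType R).

Definition complexified := (V * V)%type.
HB.instance Definition _ := GRing.Zmodule.on complexified.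

Definition cscale (a : R[i]) (w : complexified) : complexified :=
  (complex.Re a *: w.1 - complex.Im a *: w.2,
   complex.Re a *: w.2 + complex.Im a *: w.1).

Fact cscaleA a b w : cscale a (cscale b w) = cscale (a * b) w.
Proof.
case: a b w => [a a'] [b b'] [u v]; rewrite /cscale/=.
rewrite !(scalerBr, scalerDr, scalerBl, scalerDl, scalerA); congr pair.
  by rewrite !opprD -!addrA; congr (_ + _); rewrite [RHS]addrC -addrA.
by rewrite -!addrA; congr (_ + _); rewrite [RHS]addrC -addrA.
Qed.

Fact cscale1 : left_id 1 cscale.
Proof. by case=> u v; rewrite /cscale/= !scale1r !scale0r subr0 addr0. Qed.

Fact cscaleDr : right_distributive cscale +%R.
Proof.
move=> a [u v] [u' v']; rewrite /cscale/=; congr pair.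
  by rewrite !scalerDr opprD addrACA.
by rewrite !scalerDr addrACA.
Qed.

Fact cscaleDl w : {morph cscale^~ w : a b / a + b}.
Proof.
move=> [a a'] [b b']; rewrite /cscale/=; congr pair.
  by rewrite !scalerDl opprD addrACA.
by rewrite !scalerDl addrACA.
Qed.

HB.instance Definition _ := GRing.Zmodule_isLmodule.Build R[i] complexified
  cscaleA cscale1 cscaleDr cscaleDl.

Definition complexify (u : V) : complexified := (u, 0).

End complexified.

Section newman_penrose.
Context {R : realType} {M : manifold R 3}.
Local Open Scope complex_scope.

Definition triple_frame (e1 e2 xi : vector_field M) :
  'I_3 -> forall p, tangent p := tnth [tuple vf_val e1; vf_val e2; vf_val xi].

Record np_frame (g : riemannian_metric M) := NPFrame {
  np_e1 : vector_field M;
  np_e2 : vector_field M;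
  np_xi : vector_field M;
  np_orthonormal :
    orthonormal_frame g setT (triple_frame np_e1 np_e2 np_xi) }.

(* Complex-bilinear (not sesquilinear) extension. *)
Definition cmetric (g : riemannian_metric M) (p : M)
    (w z : complexified (tangent p)) : R[i] :=
  (g p w.1 z.1 - g p w.2 z.2) +i* (g p w.1 z.2 + g p w.2 z.1).

(* Complex-linear extension in the direction; only real fields are
   differentiated below. *)
Definition cnabla (D : connection M) (p : M) (w : complexified (tangent p))
    (X : vector_field M) : complexified (tangent p) :=
  (D p w.1 X, D p w.2 X).

Context {g : riemannian_metric M}.

Definition np_del (F : np_frame g) (p : M) : complexified (tangent p) :=
  ((Num.sqrt 2)^-1)%:C *:
    (complexify (np_e1 F p) - 'i *: complexify (np_e2 F p)).

Definition np_delbar (F : np_frame g) (p : M) : complexified (tangent p) :=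
  ((Num.sqrt 2)^-1)%:C *:
    (complexify (np_e1 F p) + 'i *: complexify (np_e2 F p)).

Definition rho_np (D : connection M) (F : np_frame g) (p : M) : R[i] :=
  cmetric g (np_del F p) (cnabla D (np_delbar F p) (np_xi F)).

Definition expansion_np (D : connection M) (F : np_frame g) (p : M) : R :=
  complex.Re (rho_np D F p).

End newman_penrose.

(* Main.v *)
(** The divergence of [xi] is the trace of [v |-> nabla v xi], and the trace of
    an endomorphism does not depend on the orthonormal frame, so it can be
    computed in the real frame [(e1, e2, xi)].  There the [xi]-term vanishes,
    since [2 g(nabla_xi xi, xi) = xi (g(xi, xi)) = xi 1 = 0], and the real part
    of [rho_np] is half the sum of the two remaining terms. *)
Require Import Defs.
From HB Require Import structures.
From mathcomp Require Import all_boot all_order all_algebra.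
From mathcomp Require Import boolp classical_sets functions reals topology.
From mathcomp Require Import normedtype derive complex.
Import Order.TTheory GRing.Theory Num.Theory.
Local Open Scope classical_set_scope.
Local Open Scope ring_scope.

Section pointwise_metric.
Context {R : realType} {n : nat} {M : manifold R n} (g : riemannian_metric M).
Context {p : M}.
Implicit Types u v w : tangent p.

Lemma rmetricDl u v w : g p (u + v) w = g p u w + g p v w.
Proof. by rewrite -[u in LHS]scale1r metric_linear mul1r. Qed.

Lemma rmetric0l w : g p 0 w = 0.
Proof. by apply: (addrI (g p 0 w)); rewrite -rmetricDl !addr0. Qed.

Lemma rmetricZl a u w : g p (a *: u) w = a * g p u w.
Proof. by rewrite -[a *: u]addr0 metric_linear rmetric0l addr0. Qed.

Lemma rmetricZr a u w : g p u (a *: w) = a * g p u w.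
Proof. by rewrite Defs.metric_sym rmetricZl Defs.metric_sym. Qed.

Lemma rmetric_suml (I : Type) (r : seq I) (P : pred I) (v_ : I -> tangent p) w :
  g p (\sum_(i <- r | P i) v_ i) w = \sum_(i <- r | P i) g p (v_ i) w.
Proof.
exact: (big_morph (fun v => g p v w) (fun u v => rmetricDl u v w) (rmetric0l w)).
Qed.

Lemma rmetric_sumr (I : Type) (r : seq I) (P : pred I) (v_ : I -> tangent p) w :
  g p w (\sum_(i <- r | P i) v_ i) = \sum_(i <- r | P i) g p w (v_ i).
Proof.
by rewrite Defs.metric_sym rmetric_suml; under eq_bigr do rewrite Defs.metric_sym.
Qed.

(** The Leibniz rule applied to [1 * 1] gives [v 1 = v 1 + v 1]. *)
Lemma tangent1 v : v 1 = 0.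
Proof.
have /asboolP[_ vM] := tangentP v.
have := vM 1 1; rewrite mulr1 !mul1r => v1.
by apply: (addrI (v 1)); rewrite addr0 -v1.
Qed.

(** Spanning supplies some coefficients [c]; pairing with [E i p] identifies each of them. *)
Lemma orthonormal_frame_expansion (U : set M) E : orthonormal_frame g U E ->
  U p -> forall v, v = \sum_i g p v (E i p) *: E i p.
Proof.
move=> [_ ortho span] Up v; have [c vE] := span p Up v.
rewrite [LHS]vE; apply: eq_bigr => i _; congr (_ *: _).
rewrite vE rmetric_suml (bigD1 i)//= rmetricZl ortho// eqxx mulr1 big1 ?addr0//.
by move=> j /negbTE ji; rewrite rmetricZl ortho// ji mulr0.
Qed.

(** Expanding [E i p] in [E'] on the left, and [E' j p] in [E] under [T] on the right, turns both
    sides into the double sum of [g p (E i p) (E' j p) * g p (T (E i p)) (E' j p)]. *)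
Lemma trace_orthonormal_frame (U U' : set M) E E' :
  orthonormal_frame g U E -> orthonormal_frame g U' E' -> U p -> U' p ->
  forall T : {linear tangent p -> tangent p},
  \sum_i g p (T (E i p)) (E i p) = \sum_i g p (T (E' i p)) (E' i p).
Proof.
move=> oE oE' Up U'p T.
under eq_bigr => i _ do
  rewrite [X in g p _ X](orthonormal_frame_expansion _ _ oE' U'p) rmetric_sumr.
rewrite exchange_big/=; apply: eq_bigr => j _.
rewrite [X in T X](orthonormal_frame_expansion _ _ oE Up) linear_sum rmetric_suml.
apply: eq_bigr => i _.
by rewrite linearZ rmetricZl rmetricZr [g p (E' j p) _]Defs.metric_sym.
Qed.

End pointwise_metric.

Section divergence.
Context {R : realType} {n : nat} {M : manifold R n} (g : riemannian_metric M).
Context (D : connection M).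

Lemma nablaZ (p : M) a (v : tangent p) X : D p (a *: v) X = a *: D p v X.
Proof.
have D0 : D p 0 X = 0.
  apply: (addrI (D p 0 X)).
  by rewrite -[X in X + _]scale1r -nabla_linear scaler0 !addr0.
by rewrite -[a *: v]addr0 nabla_linear D0 addr0.
Qed.

(** [D] is linear in its direction at each point, so only the values of the frames at [p] matter. *)
Lemma divergence_frame (U U' : set M) E E' (X : vector_field M) (p : M) :
  orthonormal_frame g U E -> orthonormal_frame g U' E' -> U p -> U' p ->
  divergence g D E X p = divergence g D E' X p.
Proof.
move=> oE oE' Up U'p.
pose T (v : tangent p) := D p v X.
have T_linear : linear T by move=> a u v; exact: nabla_linear.
pose isT := GRing.isLinear.Build _ _ _ _ T T_linear.
pose TL : {linear tangent p -> tangent p} := HB.pack T isT.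
exact: (trace_orthonormal_frame g _ _ _ _ oE oE' Up U'p TL).
Qed.

Lemma nabla_unit_orthogonal (X : vector_field M) : metric_compatible g D ->
  (forall p, g p (X p) (X p) = 1) ->
  forall p (v : tangent p), g p (D p v X) (X p) = 0.
Proof.
move=> gD X1 p v; have := gD p v X X.
(* The differentiated function is the constant 1, so compatibility reads
   [0 = 2 * g p (D p v X) (X p)]. *)
have -> : metric_apply g X X = 1 by apply: val_inj; apply/funext => q; exact: X1.
rewrite tangent1 [g p (X p) _]Defs.metric_sym -mulr2n => /esym/eqP.
by rewrite mulrn_eq0 => /eqP.
Qed.

End divergence.

(** By complex bilinearity the [e2] terms combine with factor [-i * i = 1], while the mixed terms
    are purely imaginary. *)
Lemma expansion_npE (R : realType) (M : manifold R 3) (g : riemannian_metric M)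
    (D : connection M) (F : np_frame g) (p : M) :
  2 * expansion_np D F p =
  g p (D p (np_e1 F p) (np_xi F)) (np_e1 F p) +
  g p (D p (np_e2 F p) (np_xi F)) (np_e2 F p).
Proof.
(* The product of the normalizing factors of [np_del] and [np_delbar]. *)
have s2 : (Num.sqrt 2)^-1 * (Num.sqrt 2)^-1 = 2^-1 :> R.
  by rewrite -invfM -expr2 sqr_sqrtr.
rewrite /expansion_np /rho_np /np_del /np_delbar /cmetric /cnabla /=.
rewrite !scale0r !scale1r !(add0r, oppr0, addr0) !nablaZ scalerN.
rewrite -scaleNr !rmetricZl !rmetricZr mulNr opprK !mulrA s2 -!mulrDr mulrA.
by rewrite mulfV ?pnatr_eq0// mul1r; congr (_ + _); exact: Defs.metric_sym.
Qed.

Theorem lemma5p14 (R : realType) (M : manifold R 3) (g : riemannian_metric M)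
    (D : connection M) (hD : levi_civita g D) (F : np_frame g)
    (U : set M) (hU : open U) (E : 'I_3 -> forall p : M, tangent p)
    (hE : orthonormal_frame g U E) (p : M) (hp : U p) :
  divergence g D E (np_xi F) p = 2 * expansion_np D F p.
Proof.
have oF := np_orthonormal F; have [_ ortho _] := oF.
rewrite (divergence_frame _ _ _ _ _ _ _ _ hE oF hp I) expansion_npE.
rewrite /divergence !big_ord_recl big_ord0 addr0 /triple_frame.
(* The default [np_xi F] is never reached; [nth] lets the three entries compute. *)
rewrite !(tnth_nth (vf_val (np_xi F)))/=.
rewrite [X in _ + (_ + X)]nabla_unit_orthogonal ?addr0//; first by case: hD.
(* [ord_max] is the index of [np_xi F] in the triple. *)
move=> q; have := ortho q I ord_max ord_max.
by rewrite eqxx /triple_frame (tnth_nth (vf_val (np_xi F))).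
Qed.
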